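(* Let $N$ be a prime number and $n\ge 1$ an integer. Then the Poincaré series (in the variables $q,t$) of the algebraic $\mathit{sl}_N$-homology with coefficients in $\mathbb{Z}_N=\mathbb{Z}/N\mathbb{Z}$, i.e. of $H^{\mathrm{alg}}_n(\mathit{sl}_N,\mathbb{Z}_N)$, equals $$\mathcal{P}^{\mathrm{alg}}_n(\mathit{sl}_N,\mathbb{Z}_N)=\prod_{k=0}^{n-1}\frac{1+q^{2N+2k}t^{2k+1}}{1-q^{2k+2}t^{2k}}\; \prod_{i=0}^{\lfloor\frac{n-1}{N}\rfloor}\frac{1-q^{2N+2iN}t^{2iN}}{1+q^{2N+2iN}t^{2iN+1}}.$$
   Context: For a commutative ring $R$ and integers $n,N\ge1$, let $\mathcal{H}_n$ be the free supercommutative $R$-algebra with even (commuting) generators $x_0,\ldots,x_{n-1}$ and odd (anticommuting, square-zero) generators $\xi_0,\ldots,\xi_{n-1}$, i.e. $R[x_0,\ldots,x_{n-1}]\otimes\Lambda_R(\xi_0,\ldots,\xi_{n-1})$. It is bigraded (by a $q$-degree and a $t$-degree, both additive under multiplication) by $$\deg x_k=q^{2k+2}t^{2k},\qquad \deg\xi_k=q^{2N+2k}t^{2k+1},$$ meaning for example that $x_k$ has $q$-degree $2k+2$ and $t$-degree $2k$. The Koszul differential $d_N$ is the odd $R$-linear derivation (graded Leibniz rule) with $$d_N(x_k)=0,\qquad d_N(\xi_k)=\sum_{i_1+\cdots+i_N=k}x_{i_1}\cdots x_{i_N},$$ the sum being over ordered tuples of non-negative integers; it preserves $q$-degree and lowers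 $t$-degree by $1$. Set $H^{\mathrm{alg}}_n(\mathit{sl}_N,R)=H(\mathcal{H}_n,d_N)$, a bigraded $R$-module. When $R$ is a field, its Poincaré series is $\sum_{a,b}\dim_R H_{(a,b)}\,q^at^b$, where $H_{(a,b)}$ is the component of $q$-degree $a$ and $t$-degree $b$. *)

(* Defs.v *)
From HB Require Import structures.
From mathcomp Require Import all_boot all_order all_algebra.
From mathcomp Require Import mpoly.
From mathcomp Require Import boolp ring zify.

Set Implicit Arguments.
Unset Strict Implicit.
Unset Printing Implicit Defensive.

Import GRing.Theory.
Local Open Scope ring_scope.

(* Univariate formal power series; bivariate ones are obtained by iteration,   *)
(* R[[q, t]] being rendered as R[[t]][[q]]. Over a comUnitRingType R, u is a   *)
(* unit exactly when its constant coefficient is (see fps_unitE).              *)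
Record fps (R : Type) := Fps { fps_coef : nat -> R }.

Lemma fpsP (R : Type) (u v : fps R) : fps_coef u =1 fps_coef v <-> u = v.
Proof. by split=> [|->//]; case: u v => u [v] /= /funext ->. Qed.

HB.instance Definition _ (R : Type) := gen_eqMixin (fps R).
HB.instance Definition _ (R : Type) := gen_choiceMixin (fps R).

Section FpsZmodule.
Variable R : zmodType.
Implicit Types u v w : fps R.

Definition fps_zero : fps R := Fps (fun=> 0).
Definition fps_opp u := Fps (fun i => - fps_coef u i).
Definition fps_add u v := Fps (fun i => fps_coef u i + fps_coef v i).

Fact fps_addA : associative fps_add.
Proof. by move=> u v w; apply/fpsP => i /=; rewrite addrA. Qed.
Fact fps_addC : commutative fps_add.
Proof. by move=> u v; apply/fpsP => i /=; rewrite addrC. Qed.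
Fact fps_add0 : left_id fps_zero fps_add.
Proof. by move=> u; apply/fpsP => i /=; rewrite add0r. Qed.
Fact fps_addN : left_inverse fps_zero fps_opp fps_add.
Proof. by move=> u; apply/fpsP => i /=; rewrite addNr. Qed.

HB.instance Definition _ :=
  GRing.isZmodule.Build (fps R) fps_addA fps_addC fps_add0 fps_addN.

Lemma fps_coefD u v i : fps_coef (u + v) i = fps_coef u i + fps_coef v i.
Proof. by []. Qed.
Lemma fps_coefN u i : fps_coef (- u) i = - fps_coef u i.
Proof. by []. Qed.
Lemma fps_coef0 i : fps_coef (0 : fps R) i = 0.
Proof. by []. Qed.
Lemma fps_coef_sum I (r : seq I) (P : pred I) (F : I -> fps R) i :
  fps_coef (\sum_(j <- r | P j) F j) i = \sum_(j <- r | P j) fps_coef (F j) i.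
Proof. by elim/big_rec2: _ => // j x y _ <-. Qed.
End FpsZmodule.

Section FpsRing.
Variable R : comNzRingType.
Implicit Types u v w : fps R.

Definition fpsC (c : R) : fps R := Fps (fun i => if i is 0 then c else 0).
Definition fpsX : fps R := Fps (fun i => (i == 1%N)%:R).
Definition fps_mul u v : fps R :=
  Fps (fun i => \sum_(j < i.+1) fps_coef u j * fps_coef v (i - j)).

Fact fps_mulC : commutative fps_mul.
Proof.
move=> u v; apply/fpsP => i /=; rewrite (reindex_inj rev_ord_inj) /=.
by apply: eq_bigr => j _; rewrite subSS mulrC subKn // leq_ord.
Qed.

Fact fps_mulA : associative fps_mul.
Proof.
move=> u v w; apply/fpsP => i /=.
pose coef3 j k := fps_coef u j * (fps_coef v (i - j - k) * fps_coef w k).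
transitivity (\sum_(j < i.+1) \sum_(k < i.+1 | (k <= i - j)%N) coef3 j k).
  apply: eq_bigr => /= j _.
  rewrite (_ : \sum_(k < _) _ = fps_coef (fps_mul w v) (i - j)) /=; last first.
    exact: (congr1 (fun u => fps_coef u (i - j)) (fps_mulC v w)).
  rewrite big_distrr /=.
  rewrite (big_ord_narrow_leq (leq_subr _ _)).
  by apply: eq_bigr => k _; rewrite /coef3 [fps_coef w _ * _]mulrC.
rewrite (exchange_big_dep predT) //= (reindex_inj rev_ord_inj) /=.
apply: eq_bigr => k _; rewrite subSS.
transitivity (\sum_(j < i.+1 | (j <= k)%N) coef3 j (i - k)%N).
  apply: eq_bigl => j; have:= leq_ord j; have:= leq_ord k => ki ji.
  by rewrite leq_sub2lE.
rewrite (big_ord_narrow_leq (leq_ord k)) big_distrl /=.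
apply: eq_bigr => j _; rewrite /coef3 mulrA; congr (_ * fps_coef v _ * _).
have:= leq_ord k; have:= leq_ord j => /= jk ki.
by rewrite subnAC subKn.
Qed.

Fact fps_mul1 : left_id (fpsC 1) fps_mul.
Proof.
move=> u; apply/fpsP => i /=; rewrite big_ord_recl subn0 mul1r.
by rewrite big1 ?addr0 // => j _; rewrite mul0r.
Qed.

Fact fps_mulDl : left_distributive fps_mul +%R.
Proof.
move=> u v w; apply/fpsP => i /=; rewrite -big_split /=.
by apply: eq_bigr => j _; rewrite mulrDl.
Qed.

Fact fps_oner_neq0 : fpsC 1 != 0.
Proof. by apply/eqP => /fpsP/(_ 0%N) /eqP; rewrite oner_eq0. Qed.

HB.instance Definition _ := GRing.Zmodule_isComNzRing.Build (fps R)
  fps_mulA fps_mulC fps_mul1 fps_mulDl fps_oner_neq0.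

Lemma fps_coefM u v i :
  fps_coef (u * v) i = \sum_(j < i.+1) fps_coef u j * fps_coef v (i - j).
Proof. by []. Qed.
Lemma fps_coef1 i : fps_coef (1 : fps R) i = (i == 0%N)%:R.
Proof. by case: i. Qed.
Lemma fps_coef0M u v : fps_coef (u * v) 0 = fps_coef u 0 * fps_coef v 0.
Proof. by rewrite fps_coefM big_ord1. Qed.
Lemma fps_coefCM c u i : fps_coef (fpsC c * u) i = c * fps_coef u i.
Proof.
by rewrite fps_coefM big_ord_recl subn0 big1 ?addr0 // => j _; rewrite mul0r.
Qed.
Lemma fps_coefX_lt u k i :
  fps_coef u 0 = 0 -> (i < k)%N -> fps_coef (u ^+ k) i = 0.
Proof.
move=> u0; elim: k i => // k IHk i lik; rewrite exprS fps_coefM big1 // => j _.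
case: (unliftP ord0 j) => [j'|] -> /=; last by rewrite u0 mul0r.
rewrite IHk ?mulr0 // /bump /= add1n ltn_subLR //.
by rewrite addSn (leq_trans lik) // ltnS leq_addl.
Qed.
End FpsRing.

Section FpsUnit.
Variable R : comUnitRingType.
Implicit Types u v w : fps R.

Definition fps_unit : pred (fps R) := fun u => fps_coef u 0 \is a GRing.unit.

(* u = c (1 - w) with c the constant coefficient and w of positive order, so   *)
(* that u^-1 = c^-1 \sum_k w^k, of which only k <= i matters in degree i.      *)
Definition fps_inv u : fps R :=
  if fps_unit u then
    let c := fps_coef u 0 in
    let w := 1 - fpsC c^-1 * u in
    Fps (fun i => c^-1 * fps_coef (\sum_(k < i.+1) w ^+ k) i)
  else u.

Fact fps_mulVr : {in fps_unit, left_inverse 1 fps_inv *%R}.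
Proof.
move=> u; rewrite unfold_in => uu; rewrite /fps_inv /fps_unit uu /=.
set c := fps_coef u 0; set w := 1 - _ * u.
have w0 : fps_coef w 0 = 0.
  by rewrite fps_coefD fps_coefN fps_coef0M /= mulVr ?subrr.
apply/fpsP => i; rewrite mulrC fps_coefM.
transitivity (fps_coef (u * (fpsC c^-1 * \sum_(k < i.+1) w ^+ k)) i).
  rewrite fps_coefM; apply: eq_bigr => j _; rewrite fps_coefCM fps_coef_sum.
  congr (_ * (_ * _)); rewrite [LHS]fps_coef_sum (big_ord_widen i.+1 (fun k => fps_coef (w ^+ k) (i - j))).
    rewrite big_mkcond; apply: eq_bigr => k _; case: ifPn => //.
    by rewrite -leqNgt => ?; rewrite fps_coefX_lt.
  by rewrite ltnS leq_subr.
rewrite mulrA [u * _]mulrC.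
have -> : fpsC c^-1 * u = 1 - w by rewrite /w subKr.
by rewrite -opprB mulNr -subrX1 opprB fps_coefD fps_coefN (@fps_coefX_lt _ w) ?subr0.
Qed.

Fact fps_unitPl u v : v * u = 1 -> fps_unit u.
Proof.
move=> /fpsP/(_ 0%N); rewrite fps_coef0M => vu1.
by apply/unitrPr; exists (fps_coef v 0); rewrite mulrC.
Qed.

Fact fps_inv_out : {in [predC fps_unit], fps_inv =1 id}.
Proof. by move=> u; rewrite inE /= unfold_in /fps_inv /fps_unit => /negPf->. Qed.

HB.instance Definition _ := GRing.ComNzRing_hasMulInverse.Build (fps R)
  fps_mulVr fps_unitPl fps_inv_out.

Lemma fps_unitE u : (u \is a GRing.unit) = (fps_coef u 0 \is a GRing.unit).
Proof. by []. Qed.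
End FpsUnit.


Section SuperAlgebra.
Variables (R : comNzRingType) (n : nat).
Local Notation P := {mpoly R[n]}.
Implicit Types (A B C S T : {set 'I_n}).

(* R[x_0, .., x_{n-1}] (x) Lambda(xi_0, .., xi_{n-1}): u S is the coefficient   *)
(* of xi_S, the product of the xi_k for k in S in increasing order.            *)
Definition superalg : Type := {ffun {set 'I_n} -> P}.

HB.instance Definition _ := GRing.Lmodule.on superalg.
Implicit Types u v w : superalg.

Definition inversions A B : nat := (\sum_(i in A) \sum_(j in B) (j < i))%N.

(* xi_A xi_B = shuffle_sign A B xi_(A :|: B) for disjoint A and B              *)
Definition shuffle_sign A B : P := (-1) ^+ inversions A B.
Local Notation sgn := shuffle_sign.

Definition super_mul u v : superalg :=
  [ffun S : {set 'I_n} => \sum_(A : {set 'I_n} | A \subset S)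
               sgn A (S :\: A) * (u A * v (S :\: A))].

Definition super_even (p : P) : superalg :=
  [ffun S : {set 'I_n} => if S == set0 then p else 0].

Fact sum_setU A B (F : 'I_n -> nat) : [disjoint A & B] ->
  (\sum_(i in A :|: B) F i = \sum_(i in A) F i + \sum_(i in B) F i)%N.
Proof. by move=> dAB; rewrite -bigU //; apply: eq_bigl => i; rewrite !inE. Qed.

Lemma sgnUl A B C : [disjoint A & B] -> sgn (A :|: B) C = sgn A C * sgn B C.
Proof.
move=> dAB; rewrite /sgn -exprD; congr (_ ^+ _).
exact: sum_setU.
Qed.

Lemma sgnUr A B C : [disjoint B & C] -> sgn A (B :|: C) = sgn A B * sgn A C.
Proof.
move=> dBC; rewrite /sgn -exprD /inversions -big_split; congr (_ ^+ _).
by apply: eq_bigr => i _; rewrite sum_setU.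
Qed.

Lemma sgn0l A : sgn set0 A = 1.
Proof. by rewrite /sgn /inversions big_set0. Qed.

Lemma sgn0r A : sgn A set0 = 1.
Proof. by rewrite /sgn /inversions big1 // => i _; rewrite big_set0. Qed.

Lemma sgn_sqr A B : sgn A B * sgn A B = 1.
Proof. by rewrite /sgn -expr2 sqrr_sign. Qed.

Lemma sgn1C A (k : 'I_n) : k \notin A ->
  sgn A [set k] = (-1) ^+ #|A| * sgn [set k] A.
Proof.
move=> kA; have <- : (inversions A [set k] + inversions [set k] A)%N = #|A|.
  rewrite /inversions big_set1 -big_split -sum1_card /=; apply: eq_bigr => i iA.
  rewrite big_set1; case: (ltngtP i k) => // /val_inj ik.
  by rewrite -ik iA in kA.
by rewrite exprD -mulrA sgn_sqr mulr1.
Qed.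

Lemma setUDK A B S : A \subset S -> B \subset S :\: A -> (A :|: B) :\: A = B.
Proof.
move=> _; rewrite subsetD => /andP[_ /disjoint_setI0 BA].
apply/setP => i; rewrite !inE; case: (boolP (i \in A)) => //= iA.
by move/setP/(_ i): BA; rewrite !inE iA andbT => ->.
Qed.

Fact super_mulA : associative super_mul.
Proof.
move=> u v w; apply/ffunP => S; rewrite !ffunE.
under [RHS]eq_bigr => C _ do rewrite ffunE mulr_suml mulr_sumr.
rewrite (exchange_big_dep (fun A => A \subset S)) /=; last first.
  by move=> C A CS sAC; apply: subset_trans CS.
apply: eq_bigr => A AS; rewrite ffunE !mulr_sumr.
rewrite [RHS](reindex_onto (fun B => A :|: B) (fun C => C :\: A)) /=; last first.
  by move=> C /andP[_ sAC]; rewrite -{1}(setIidPr sAC) finset.setID.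
apply: eq_big => [B|B BSA].
  apply/idP/idP => [BSA|/andP[/andP[BS _] /eqP <-]].
    by rewrite (setUDK AS BSA) eqxx subsetUl subUset AS (subset_trans BSA (subsetDl _ _)).
  exact/setSD/BS.
rewrite (setUDK AS BSA) setDDl.
have dAB : [disjoint A & B].
  by move: BSA; rewrite subsetD disjoint_sym => /andP[].
have -> : S :\: A = B :|: (S :\: (A :|: B)).
  by rewrite -setDDl -{1}(setID (S :\: A) B) (setIidPr BSA).
rewrite sgnUr ?sgnUl //; first by ring.
by rewrite -setDDl -setI_eq0 setIDA setIC -setIDA setDv setI0.
Qed.

Fact super_mul1l : left_id (super_even 1) super_mul.
Proof.
move=> u; apply/ffunP => S; rewrite ffunE (bigD1 set0) ?sub0set //= setD0.
rewrite sgn0l ffunE eqxx !mul1r big1 ?addr0 // => A /andP[_ /negPf A0].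
by rewrite ffunE A0 mul0r mulr0.
Qed.

Fact super_mul1r : right_id (super_even 1) super_mul.
Proof.
move=> u; apply/ffunP => S; rewrite ffunE (bigD1 S) //= setDv.
rewrite sgn0r ffunE eqxx mul1r mulr1 big1 ?addr0 // => A /andP[AS nAS].
rewrite ffunE setD_eq0; case: ifP; last by rewrite !mulr0.
by move=> SA; rewrite eqEsubset AS SA in nAS.
Qed.

Fact super_mulDl : left_distributive super_mul +%R.
Proof.
move=> u v w; apply/ffunP => S; rewrite !ffunE -big_split /=.
by apply: eq_bigr => A _; rewrite ffunE mulrDl mulrDr.
Qed.

Fact super_mulDr : right_distributive super_mul +%R.
Proof.
move=> u v w; apply/ffunP => S; rewrite !ffunE -big_split /=.
by apply: eq_bigr => A _; rewrite ffunE !mulrDr.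
Qed.

Fact super_oner_neq0 : super_even 1 != 0.
Proof. by apply/eqP => /ffunP/(_ set0)/eqP; rewrite !ffunE eqxx oner_eq0. Qed.

HB.instance Definition _ := GRing.Zmodule_isNzRing.Build superalg
  super_mulA super_mul1l super_mul1r super_mulDl super_mulDr super_oner_neq0.

Fact super_scaleAl (c : R) u v : c *: (u * v) = (c *: u) * v.
Proof.
apply/ffunP => S; rewrite !ffunE scaler_sumr; apply: eq_bigr => A _.
by rewrite ffunE -scalerAl -scalerAr.
Qed.

HB.instance Definition _ :=
  GRing.Lmodule_isLalgebra.Build R superalg super_scaleAl.

Fact super_scaleAr (c : R) u v : c *: (u * v) = u * (c *: v).
Proof.
apply/ffunP => S; rewrite !ffunE scaler_sumr; apply: eq_bigr => A _.
by rewrite ffunE -!scalerAr.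
Qed.

HB.instance Definition _ :=
  GRing.Lalgebra_isAlgebra.Build R superalg super_scaleAr.

Lemma superME u v S : (u * v) S =
  \sum_(A : {set 'I_n} | A \subset S) sgn A (S :\: A) * (u A * v (S :\: A)).
Proof. exact: ffunE. Qed.

Lemma super_evenME p u S : (super_even p * u) S = p * u S.
Proof.
rewrite superME (bigD1 set0) ?sub0set //= setD0 sgn0l ffunE eqxx mul1r.
by rewrite big1 ?addr0 // => A /andP[_ /negPf A0]; rewrite ffunE A0 mul0r mulr0.
Qed.

Lemma super_even_central p u : super_even p * u = u * super_even p.
Proof.
apply/ffunP => S; rewrite super_evenME superME (bigD1 S) //= setDv sgn0r.
rewrite ffunE eqxx mul1r mulrC big1 ?addr0 // => A /andP[AS nAS].
rewrite ffunE setD_eq0; case: ifP; last by rewrite !mulr0.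
by move=> SA; rewrite eqEsubset AS SA in nAS.
Qed.

Fact super_even_is_zmod_morphism : zmod_morphism super_even.
Proof.
by move=> p q; apply/ffunP => S; rewrite !ffunE; case: ifP; rewrite ?subr0.
Qed.
HB.instance Definition _ :=
  GRing.isZmodMorphism.Build P superalg super_even super_even_is_zmod_morphism.

Fact super_even_is_monoid_morphism : monoid_morphism super_even.
Proof.
split=> // p q; apply/ffunP => S.
by rewrite super_evenME !ffunE; case: ifP; rewrite ?mulr0.
Qed.
HB.instance Definition _ :=
  GRing.isMonoidMorphism.Build P superalg super_even super_even_is_monoid_morphism.

Definition super_x (k : 'I_n) : superalg := super_even 'X_k.
Definition super_xiS S : superalg := [ffun T : {set 'I_n} => (T == S)%:R].
Definition super_xi (k : 'I_n) : superalg := super_xiS [set k].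

(* The sign automorphism u |-> (-1)^|u| u of the Z/2-grading.                  *)
Definition super_sign u : superalg :=
  [ffun S : {set 'I_n} => (-1) ^+ #|S| * u S].

(* The left derivative d/dxi_k: the sign is that of xi_k xi_S = +- xi_(k |: S). *)
Definition super_deriv (k : 'I_n) u : superalg :=
  [ffun S : {set 'I_n} => if k \in S then 0 else sgn [set k] S * u (k |: S)].

Lemma sum_subsetU1 (k : 'I_n) T (F : {set 'I_n} -> P) : k \notin T ->
  \sum_(C : {set 'I_n} | C \subset k |: T) F C =
  \sum_(A : {set 'I_n} | A \subset T) (F A + F (k |: A)).
Proof.
move=> kT; rewrite (bigID (fun C : {set 'I_n} => k \in C)) /= addrC big_split.
congr +%R.
  apply: eq_bigl => A; apply/andP/idP => [[AkT kA]|AT].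
    apply/subsetP => i iA; have := subsetP AkT i iA; rewrite !inE.
    by case: eqP => // ik; rewrite -ik iA in kA.
  by rewrite (subset_trans AT) ?subsetU1 // (contra (subsetP AT k)).
rewrite (reindex_onto (fun A => k |: A) (fun C => C :\ k)) /=; last first.
  by move=> C /andP[_ kC]; rewrite setD1K.
apply: eq_bigl => A; rewrite setU11 andbT.
apply/andP/idP => [[kAT /eqP <-]|AT].
  by rewrite subDset; apply: subset_trans kAT _.
by rewrite setUS // setU1K ?eqxx // (contra (subsetP AT k)).
Qed.

Fact super_deriv_is_linear k : linear (super_deriv k).
Proof.
move=> c u v; apply/ffunP => S; rewrite !ffunE; case: ifP => _.
  by rewrite scaler0 addr0.
by rewrite mulrDr scalerAr.
Qed.
HB.instance Definition _ k := GRing.isLinear.Build R superalg superalg _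
  (super_deriv k) (super_deriv_is_linear k).

Fact disjoint1s (k : 'I_n) A : k \notin A -> [disjoint [set k] & A].
Proof. by rewrite disjoints1. Qed.

Fact setU1D (k : 'I_n) A T : k \notin A -> (k |: T) :\: A = k |: (T :\: A).
Proof.
by move=> kA; rewrite setDUl; congr (_ :|: _); apply/setDidPl/disjoint1s.
Qed.

Fact setU1DU1 (k : 'I_n) A T : k \notin T -> (k |: T) :\: (k |: A) = T :\: A.
Proof.
move=> kT; apply/setP => i; rewrite !inE; case: eqP => [->|] //=.
by rewrite (negPf kT) andbF.
Qed.

Lemma super_derivM k u v : super_deriv k (u * v) =
  super_deriv k u * v + super_sign u * super_deriv k v.
Proof.
apply/ffunP => S; rewrite [LHS]ffunE [RHS]ffunE !superME.
case: (boolP (k \in S)) => kS.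
  rewrite -(setD1K kS); set T := S :\ k.
  have kT : k \notin T by rewrite !inE eqxx.
  rewrite !sum_subsetU1 // -big_split big1 //= => A AT.
  have kA : k \notin A by apply: contra kT; apply: (subsetP AT).
  have kTA : k \notin T :\: A by rewrite inE (negPf kT) andbF.
  rewrite (setU1D _ kA) (setU1DU1 A kT) !ffunE !(setU11, negPf kA, negPf kTA).
  rewrite sgnUl ?sgnUr ?disjoint1s // sgn1C // cardsU1 kA exprS.
  have := sgn_sqr [set k] A; have := sgn_sqr [set k] (T :\: A).
  set s1 := sgn _ (T :\: A); set s2 := sgn _ A => s1E s2E.
  set e := (-1) ^+ _; set s := sgn A _; set a := u _; set b := v (k |: _).
  transitivity (e * s * a * b * (s2 * s2 - s1 * s1)); first by ring.
  by rewrite s1E s2E subrr mulr0.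
rewrite sum_subsetU1 // -big_split mulr_sumr /=; apply: eq_bigr => A AS.
have kA : k \notin A by apply: contra kS; apply: (subsetP AS).
have kSA : k \notin S :\: A by rewrite inE (negPf kS) andbF.
rewrite (setU1D _ kA) (setU1DU1 A kS) !ffunE (negPf kA) (negPf kSA).
have -> : sgn [set k] S = sgn [set k] A * sgn [set k] (S :\: A).
  rewrite -sgnUr; last by rewrite -setI_eq0 setIDA setIC -setIDA setDv setI0.
  by rewrite -{1}(setID S A) (setIidPr AS).
rewrite sgnUl ?sgnUr ?disjoint1s // sgn1C //.
have := sgn_sqr [set k] A; have := sgn_sqr [set k] (S :\: A).
set s1 := sgn _ (S :\: A); set s2 := sgn _ A => s1E s2E.
set e := (-1) ^+ _; set s := sgn A _; set a := u A; set b := v (k |: _).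
set c := u _; set d := v _.
transitivity (e * s * a * b * s1 * (s2 * s2) + s2 * s * c * d * (s1 * s1)).
  by ring.
by rewrite s1E s2E; ring.
Qed.


Lemma super_xiSM A B : super_xiS A * super_xiS B =
  if [disjoint A & B] then super_even (sgn A B) * super_xiS (A :|: B) else 0.
Proof.
apply/ffunP => S; rewrite superME.
have [dAB|dAB] := ifP; last first.
  rewrite big1 ?ffunE // => C CS; rewrite !ffunE; case: eqP => [CA|_].
    case: eqP => [SB|_]; last by rewrite !mulr0.
    by rewrite -CA -SB -setI_eq0 setIDA setIC -setIDA setDv setI0 eqxx in dAB.
  by rewrite mul0r mulr0.
have dBA : B :\: A = B by apply/setDidPl; rewrite disjoint_sym.
rewrite super_evenME ffunE; case: eqP => [->|SAB].
  rewrite (bigD1 A) ?subsetUl //= setDUl setDv set0U dBA !ffunE !eqxx !mulr1.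
  by rewrite big1 ?addr0 // => C /andP[_ /negPf CA]; rewrite ffunE CA mul0r mulr0.
rewrite mulr0 big1 // => C CS; rewrite !ffunE; case: eqP => [CA|_].
  case: eqP => [SB|_]; last by rewrite !mulr0.
  by case: SAB; rewrite -SB -CA -{1}(setID S C) (setIidPr CS).
by rewrite mul0r mulr0.
Qed.

Lemma super_xi_sqr k : super_xi k * super_xi k = 0.
Proof. by rewrite super_xiSM disjoints1 !inE eqxx. Qed.

Lemma super_xi_anticomm j k : super_xi j * super_xi k = - (super_xi k * super_xi j).
Proof.
have [->|jk] := eqVneq j k; first by rewrite super_xi_sqr oppr0.
rewrite !super_xiSM !disjoints1 !inE jk eq_sym jk setUC.
rewrite sgn1C ?inE 1?eq_sym // cards1 expr1 -mulNr; congr (_ * _).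
by apply/ffunP => S; rewrite !ffunE; case: ifP; rewrite ?oppr0 ?mulN1r.
Qed.

Lemma super_xiSE S : super_xiS S = \prod_(k < n | k \in S) super_xi k.
Proof.
rewrite -big_filter; set s := filter _ _.
have -> : S = [set k in s].
  by apply/setP => k; rewrite inE mem_filter mem_index_enum andbT.
suff: pairwise (fun i j : 'I_n => (i < j)%N) s.
  elim: s => [|k s IHs] /=.
    by rewrite big_nil => _; apply/ffunP => T; rewrite !ffunE set_nil; case: eqP.
  move=> /andP[/allP ks /IHs IH]; rewrite big_cons -IH super_xiSM disjoints1 inE.
  rewrite set_cons; case: ifPn => [ks'|/negPn /ks]; last by rewrite ltnn.
  rewrite /sgn /inversions big_set1 big1 ?expr0 ?mul1r //.
  by move=> j; rewrite inE => /ks kj; rewrite ltnNge (ltnW kj).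
apply: pairwise_filter; rewrite -(pairwise_map (@nat_of_ord n) ltn).
  by rewrite /index_enum -enumT val_enum_ord -sorted_pairwise ?iota_ltn_sorted //;
     apply: ltn_trans.
Qed.

Lemma superE u : u = \sum_(S : {set 'I_n}) super_even (u S) * super_xiS S.
Proof.
apply/ffunP => S; rewrite sum_ffunE (bigD1 S) //= super_evenME ffunE eqxx mulr1.
rewrite big1 ?addr0 // => T /negPf TS.
by rewrite super_evenME ffunE eq_sym TS mulr0.
Qed.

Lemma super_deriv_even k p : super_deriv k (super_even p) = 0.
Proof.
apply/ffunP => S; rewrite !ffunE; case: ifP => // kS.
by rewrite -cards_eq0 cardsU1 kS mulr0.
Qed.

Lemma super_deriv_xi k j : super_deriv k (super_xi j) = (k == j)%:R.
Proof.
have -> : (k == j)%:R = super_even (k == j)%:R.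
  by case: eqP => // _; apply/ffunP => S; rewrite !ffunE if_same.
apply/ffunP => S; rewrite !ffunE; case: (boolP (k \in S)) => kS.
  by case: eqP => // S0; rewrite S0 inE in kS.
case: (eqVneq S set0) => [->|S0]; first by rewrite sgn0r setU0 mul1r (inj_eq set1_inj).
case: eqP => [kSj|_]; last by rewrite mulr0.
have := congr1 (fun A : {set _} => #|A|) kSj.
by rewrite /= cardsU1 kS cards1 => -[/eqP]; rewrite cards_eq0 (negPf S0).
Qed.

Lemma super_deriv2 k l u : super_deriv k (super_deriv l u) =
  if k == l then 0 else - super_deriv l (super_deriv k u).
Proof.
apply/ffunP => S; case: (eqVneq k l) => [<-|kl].
  by rewrite !ffunE setU11 mulr0 if_same.
rewrite !ffunE !inE (negPf kl) eq_sym (negPf kl) /=.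
case: ifPn => kS; case: ifPn => lS; rewrite ?mulr0 ?oppr0 //.
rewrite !sgnUr ?disjoint1s // setUCA -mulrN; rewrite (@sgn1C [set k]) ?inE 1?eq_sym //.
by rewrite cards1; ring.
Qed.

(* The value prescribed on xi_k. As i_1 + .. + i_N = k forces every i_j <= k,  *)
(* it suffices to let the i_j range over 'I_n.                                 *)
Definition koszul_f (N k : nat) : superalg :=
  \sum_(i : {ffun 'I_N -> 'I_n} | (\sum_(j < N) i j)%N == k)
    \prod_(j < N) super_x (i j).

(* The odd derivation d_N = \sum_k d_N(xi_k) d/dxi_k.                          *)
Definition koszul_d (N : nat) u : superalg :=
  \sum_(k < n) koszul_f N k * super_deriv k u.

Lemma koszul_f_even N k : koszul_f N k =
  super_even (\sum_(i : {ffun 'I_N -> 'I_n} | (\sum_(j < N) i j)%N == k)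
                \prod_(j < N) 'X_(i j)).
Proof.
by rewrite rmorph_sum; apply: eq_bigr => i _; rewrite rmorph_prod.
Qed.

Fact koszul_d_is_linear N : linear (koszul_d N).
Proof.
move=> c u v; rewrite /koszul_d scaler_sumr -big_split; apply: eq_bigr => k _ /=.
by rewrite linearP mulrDr scalerAr.
Qed.
HB.instance Definition _ N := GRing.isLinear.Build R superalg superalg _
  (koszul_d N) (koszul_d_is_linear N).

Lemma koszul_dM N u v :
  koszul_d N (u * v) = koszul_d N u * v + super_sign u * koszul_d N v.
Proof.
rewrite /koszul_d mulr_suml mulr_sumr -big_split; apply: eq_bigr => k _ /=.
by rewrite super_derivM mulrDr koszul_f_even !mulrA (super_even_central _ (super_sign u)).
Qed.

Lemma koszul_d_x N k : koszul_d N (super_x k) = 0.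
Proof. by apply: big1 => j _; rewrite super_deriv_even mulr0. Qed.

Lemma koszul_d_xi N k : koszul_d N (super_xi k) = koszul_f N k.
Proof.
rewrite /koszul_d (bigD1 k) //= super_deriv_xi eqxx mulr1 big1 ?addr0 // => j jk.
by rewrite super_deriv_xi (negPf jk) mulr0.
Qed.

Lemma koszul_dd N u : koszul_d N (koszul_d N u) = 0.
Proof.
have dE k : super_deriv k (koszul_d N u) =
    \sum_(l < n) koszul_f N l * super_deriv k (super_deriv l u).
  rewrite linear_sum; apply: eq_bigr => l _; rewrite /= super_derivM.
  rewrite koszul_f_even super_deriv_even mul0r add0r; congr (_ * _).
  apply/ffunP => S; rewrite !ffunE; case: eqP => [->|_]; last by rewrite mulr0.
  by rewrite cards0 mul1r.
rewrite {1}/koszul_d; under eq_bigr => k _ do rewrite dE mulr_sumr.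
pose F (k l : 'I_n) := koszul_f N k * (koszul_f N l * super_deriv k (super_deriv l u)).
have Fkk k : F k k = 0 by rewrite /F super_deriv2 eqxx !mulr0.
have Fkl k l : F k l = - F l k.
  have [->|kl] := eqVneq k l; first by rewrite Fkk oppr0.
  rewrite /F super_deriv2 (negPf kl) !mulrN !mulrA; congr (- (_ * _)).
  by rewrite !koszul_f_even super_even_central.
transitivity (\sum_(k < n) \sum_(l < n) F k l) => //.
have -> : \sum_(k < n) \sum_(l < n) F k l =
    \sum_(k < n) \sum_(l < n | (k < l)%N) F k l + \sum_(k < n) \sum_(l < n | (l < k)%N) F k l.
  rewrite -big_split; apply: eq_bigr => k _ /=.
  rewrite (bigID (fun l : 'I_n => (k < l)%N)) /=; congr +%R.
  rewrite (bigD1 k) ?ltnn //= Fkk add0r; apply: eq_bigl => l.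
  by rewrite -leqNgt ltn_neqAle andbC.
rewrite [X in _ + X](exchange_big_dep predT) //= -big_split big1 //= => k _.
by rewrite -big_split big1 //= => l _; rewrite Fkl addNr.
Qed.

End SuperAlgebra.

Section Bidegree.
Variables (R : comNzRingType) (n N : nat).
Implicit Types (S : {set 'I_n}) (m : 'X_{1..n}) (u : superalg R n).

(* The q-degree and t-degree of x^m xi_S.                                      *)
Definition qdeg m S : nat :=
  (\sum_(k < n) m k * (2 * k + 2) + \sum_(k in S) (2 * N + 2 * k))%N.
Definition tdeg m S : nat :=
  (\sum_(k < n) m k * (2 * k) + \sum_(k in S) (2 * k + 1))%N.

Definition bihomog (a b : nat) u : Prop :=
  forall S m, m \in msupp (u S) -> qdeg m S = a /\ tdeg m S = b.

Fact sum_mnm1 (i : {ffun 'I_N -> 'I_n}) (w : nat -> nat) :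
  (\sum_(l < n) (\sum_(j < N) U_(i j))%MM l * w l = \sum_(j < N) w (i j))%N.
Proof.
under eq_bigr => l _ do rewrite mnm_sumE big_distrl.
rewrite exchange_big /=; apply: eq_bigr => j _.
rewrite (bigD1 (i j)) //= mnm1E eqxx mul1n big1 ?addn0 // => l /negPf lij.
by rewrite mnm1E eq_sym lij.
Qed.

Lemma koszul_d_bihomog a b u :
  bihomog a b u -> bihomog a b.-1 (koszul_d N u).
Proof.
move=> hu S m; rewrite /koszul_d sum_ffunE => /msupp_sum_le.
move=> /flatten_mapP[k _]; rewrite koszul_f_even super_evenME ffunE.
case: ifPn => kS; first by rewrite mulr0 msupp0.
move=> /msuppM_le /allpairsP[[m1 m2] /= [m1P m2P ->]].
have {m2P} [<- <-] : qdeg m2 (k |: S) = a /\ tdeg m2 (k |: S) = b.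
  apply: hu; move: m2P; rewrite /shuffle_sign -signr_odd.
  by case: odd; rewrite ?mulN1r ?mul1r // (perm_mem (msuppN _)).
have : (\sum_(l < n) m1 l * (2 * l + 2) = 2 * k + 2 * N /\
        \sum_(l < n) m1 l * (2 * l) = 2 * k)%N.
  move/msupp_sum_le: m1P => /flatten_mapP[i]; rewrite mem_filter => /andP[/eqP ik _].
  rewrite -(big_morph _ (@mpolyXD n R) (@mpolyX0 n R)) => /mem_msuppXP <-.
  rewrite (sum_mnm1 _ (fun l => 2 * l + 2)%N) (sum_mnm1 _ (muln 2)).
  rewrite big_split /= -!big_distrr /= ik sum_nat_const card_ord.
  by rewrite [(N * 2)%N]mulnC.
rewrite /qdeg /tdeg !big_setU1 //=.
have mD (w : nat -> nat) : (\sum_(l < n) (m1 + m2)%MM l * w l =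
    \sum_(l < n) m1 l * w l + \sum_(l < n) m2 l * w l)%N.
  by rewrite -big_split; apply: eq_bigr => l _; rewrite mnmDE mulnDl.
rewrite (mD (fun l => 2 * l + 2)%N) (mD (muln 2)) => -[-> ->].
move: (\sum_(l < n) m2 l * (2 * l + 2))%N (\sum_(l < n) m2 l * (2 * l))%N.
move: (\sum_(l in S) (2 * N + 2 * l))%N (\sum_(l in S) (2 * l + 1))%N.
by move=> x y z t; split; lia.
Qed.

End Bidegree.

(* The classes of the h i form a basis of Z / (Z `&` B), for subspaces Z and B. *)
Definition basis_mod (F : fieldType) (V : lmodType F) (Z B : V -> Prop)
    (r : nat) (h : 'I_r -> V) : Prop :=
  [/\ forall i, Z (h i),
      forall z, Z z -> exists c : 'I_r -> F, B (z - \sum_(i < r) c i *: h i)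
    & forall c : 'I_r -> F, B (\sum_(i < r) c i *: h i) -> forall i, c i = 0].

Section Homology.
Variables (F : fieldType) (n N : nat).

Definition cycle (a b : nat) (u : superalg F n) : Prop :=
  bihomog N a b u /\ koszul_d N u = 0.
Definition boundary (u : superalg F n) : Prop := exists w, u = koszul_d N w.

(* The component of bidegree (a, b) of ker d_N / im d_N has dimension r. By    *)
(* koszul_d_bihomog it does not matter whether the w in boundary is required   *)
(* to be bihomogeneous.                                                        *)
Definition homology_dim (a b r : nat) : Prop :=
  exists h : 'I_r -> superalg F n, basis_mod (cycle a b) boundary h.

Fact homology_dim_le a b r s :
  homology_dim a b r -> homology_dim a b s -> (r <= s)%N.
Proof.
move=> [h [hZ _ hfree]] [h' [_ hgen _]].
have /choice[c cP] i := hgen _ (hZ i).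
pose M := \matrix_(i < r, j < s) c i j.
rewrite leqNgt; apply/negP => sr.
have : kermx M != 0.
  by rewrite kermx_eq0 -row_leq_rank -ltnNge (leq_ltn_trans (rank_leq_col _)).
case/rowV0Pn => v /sub_kermxP vM /rV0Pn[i]; apply/negP; rewrite negbK.
apply/eqP; apply: hfree i.
have /choice[w wP] := cP.
exists (\sum_i v 0 i *: w i); rewrite linear_sum /=.
apply/eqP; rewrite -subr_eq0 -sumrB; apply/eqP.
transitivity (\sum_(i < r) v 0 i *: \sum_(j < s) c i j *: h' j).
  apply: eq_bigr => i _; rewrite linearZ /= -wP scalerBr opprB addrC subrK //.
under eq_bigr => i _ do rewrite scaler_sumr.
rewrite exchange_big big1 //= => j _.
under eq_bigr => i _ do rewrite scalerA.
rewrite -scaler_suml; have /rowP/(_ j) := vM; rewrite !mxE => vMj.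
rewrite (eq_bigr (fun i => v 0 i * M i j)) ?vMj ?scale0r // => i _.
by rewrite mxE.
Qed.

(* The coefficient of q^a t^b in P is fps_coef (fps_coef P a) b.                *)
Definition is_poincare_series (P : fps (fps int)) : Prop :=
  forall a b : nat, exists2 r : nat,
    homology_dim a b r & fps_coef (fps_coef P a) b = r%:R.

Lemma poincare_series_uniq P Q :
  is_poincare_series P -> is_poincare_series Q -> P = Q.
Proof.
move=> hP hQ; apply/fpsP => a; apply/fpsP => b.
have [r hr ->] := hP a b; have [s hs ->] := hQ a b; congr _%:R.
by apply/eqP; rewrite eqn_leq (homology_dim_le hr hs) (homology_dim_le hs hr).
Qed.

End Homology.

Definition fps_q : fps (fps int) := fpsX (fps int).
Definition fps_t : fps (fps int) := fpsC (fpsX int).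

(* Main.v *)
(* In characteristic N the Frobenius map gives (\sum_i x_i z^i)^N =           *)
(* \sum_i x_i^N z^(iN), so d_N(xi_(iN)) = x_i^N and d_N(xi_k) = 0 when N does  *)
(* not divide k. Hence d_N is the Koszul differential of the regular sequence  *)
(* (x_i^N) for iN < n, and the homology has as a basis the monomials x^m xi_S  *)
(* with m_i < N whenever iN < n and with no multiple of N in S: a cycle is     *)
(* reduced to these one variable x_i at a time by an explicit homotopy, and    *)
(* every monomial of a boundary is divisible by some x_i^N with iN < n.        *)

From HB Require Import structures.
Require Import Defs.
From mathcomp Require Import all_boot all_order all_algebra.
From mathcomp Require Import mpoly.
From mathcomp Require Import ring zify.

Set Implicit Arguments.
Unset Strict Implicit.
Unset Printing Implicit Defensive.

Import GRing.Theory.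
Local Open Scope ring_scope.

(** By Frobenius, [d_N(xi_k)] is [x_i^N] if [k = iN] and 0 otherwise, so homology is represented by
    the reduced monomials: no [x_i^N] with [iN < n], no [xi_k] with [N] dividing [k]. They span
    because dividing by [x_i^N] and multiplying by [xi_(iN)] is a contracting homotopy
    ([koszul_homotopy]). Applied to a cycle, it removes all monomials containing [x_i^N] or
    [xi_(iN)] and adds none, so the variables can be treated in turn ([cycle_reduce]). They are
    independent because no reduced monomial occurs in a boundary ([boundary_reduced]). Hence each
    homology dimension counts reduced monomials ([homology_dim_reduced]). In the product formula,
    the second product cancels the factors [1 + w k] with [N] dividing [k] and truncates to [N]
    terms the geometric series of each [x_i] with [iN < n]. What remains, once expanded, is the
    generating function of reduced monomials. *)

Lemma mcoeffMX_if (R : comNzRingType) (n : nat) (p : {mpoly R[n]}) (e m : 'X_{1..n}) :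
  (p * 'X_[e])@_m = if (e <= m)%MM then p@_(m - e) else 0.
Proof.
case: ifPn => [em | nem]; first by rewrite -{1}(submK em) addmC mcoeffMX.
apply/eqP; rewrite mcoeff_eq0 (perm_mem (msuppMX _ _)).
apply: contra nem => /mapP[m' _ ->]; apply/mnm_lepP => i; rewrite mnmDE.
exact: leq_addr.
Qed.

(** * Frobenius and the values of the differential *)

Lemma Frobenius_sum (R : comNzRingType) (p : nat) (I : Type) (r : seq I) (F : I -> R) :
  p \in [pchar R] -> (\sum_(i <- r) F i) ^+ p = \sum_(i <- r) F i ^+ p.
Proof.
move=> pR; elim: r => [|i r IHr]; last first.
  by rewrite !big_cons exprDn_pchar ?pnatE ?IHr ?(pcharf_prime pR).
by rewrite !big_nil expr0n gtn_eqF ?prime_gt0 ?(pcharf_prime pR).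
Qed.

(* Coefficient of z^k in (\sum_i x_i z^i)^N = \sum_i x_i^N z^(iN). *)
Lemma sum_prodX_pchar (R : comNzRingType) (n N k : nat) : N \in [pchar R] ->
  \sum_(i : {ffun 'I_N -> 'I_n} | (\sum_(j < N) i j)%N == k) \prod_(j < N) 'X_(i j)
  = \sum_(i < n | (i * N)%N == k) 'X_i ^+ N :> {mpoly R[n]}.
Proof.
move=> NR; pose P := {mpoly R[n]}.
have NP : N \in [pchar {poly P}].
  rewrite pchar_poly inE (pcharf_prime NR) /=.
  by rewrite -(rmorph_nat (@mpolyC n R)) (pcharf0 NR) rmorph0.
pose x : {poly P} := \sum_(i < n) ('X_i : P) *: 'X^i.
have xN : x ^+ N = \sum_(i < n) ('X_i ^+ N : P) *: 'X^(i * N).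
  by rewrite Frobenius_sum //; apply: eq_bigr => i _; rewrite exprZn -exprM.
(* The same coefficient is computed twice: by expanding the product over all tuples, and by
   Frobenius. *)
have : (x ^+ N)`_k = (x ^+ N)`_k by [].
rewrite {2}xN -{1}[N]card_ord -prodr_const bigA_distr_bigA /= !coef_sum.
rewrite [X in _ = X -> _](eq_bigr
  (fun i : 'I_n => if (i * N)%N == k then 'X_i ^+ N else 0 : P)).
  rewrite -[X in _ = X -> _]big_mkcond /= => <-; rewrite [LHS]big_mkcond /=.
  apply: eq_bigr => i _.
  rewrite -(eq_bigr _ (fun j _ => mul_polyC _ _)) big_split /= -rmorph_prod.
  rewrite mul_polyC coefZ -(big_morph _ (exprD 'X) (expr0 _)) coefXn eq_sym.
  by case: eqP; rewrite ?mulr1 ?mulr0.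
by move=> i _; rewrite coefZ coefXn eq_sym; case: eqP; rewrite ?mulr1 ?mulr0.
Qed.

(** * Division by a monomial *)

Section MonomialDivision.
Variables (R : comNzRingType) (n : nat).
Implicit Types (p : {mpoly R[n]}) (e m : 'X_{1..n}).

(** A linear left inverse of multiplication by [x^e]; the dropped monomials form the remainder. *)
Definition mdivX e p : {mpoly R[n]} :=
  \sum_(m <- msupp p | (e <= m)%MM) p@_m *: 'X_[m - e].

Lemma mcoeff_mdivX e p m : (mdivX e p)@_m = p@_(m + e).
Proof.
rewrite raddf_sum big_mkcond [in RHS](mpolyE p) raddf_sum /=.
apply: eq_bigr => m' _; rewrite !mcoeffZ !mcoeffX; case: ifPn => [em | nem].
  congr (_ * _%:R).
  by congr nat_of_bool; apply/eqP/eqP => [<- | ->]; rewrite ?submK ?addmK.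
case: eqP => [m'E | _]; last by rewrite mulr0.
by case/mnm_lepP: nem => i; rewrite m'E mnmDE; exact: leq_addl.
Qed.

Fact mdivX_is_linear e : linear (mdivX e).
Proof.
by move=> c p q; apply/mpolyP => m; rewrite !(mcoeffD, mcoeffZ, mcoeff_mdivX).
Qed.
HB.instance Definition _ e :=
  GRing.isLinear.Build R {mpoly R[n]} {mpoly R[n]} _ (mdivX e) (mdivX_is_linear e).

Lemma mdivXK e p : mdivX e ('X_[e] * p) = p.
Proof. by apply/mpolyP => m; rewrite mcoeff_mdivX mulrC addmC mcoeffMX. Qed.

(** [x^e] and [x^e'] share no variable, so multiplying by one does not affect divisibility by the
    other. *)
Lemma mdivX_mulX e e' p : (forall i, e i = 0%N \/ e' i = 0%N) ->
  mdivX e ('X_[e'] * p) = 'X_[e'] * mdivX e p.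
Proof.
move=> ee'; apply/mpolyP => m; rewrite mcoeff_mdivX ![_ * mdivX _ _]mulrC.
rewrite !['X_[_] * _]mulrC !mcoeffMX_if mcoeff_mdivX.
have -> : (e' <= m + e)%MM = (e' <= m)%MM.
  apply/mnm_lepP/mnm_lepP => le i; have := le i; rewrite mnmDE;
  by case: (ee' i) => ->; lia.
case: ifP => // /mnm_lepP le; congr (_@_ _); apply/mnmP => i.
by have := le i; rewrite !(mnmDE, mnmBE); lia.
Qed.

Lemma mcoeff_mdivX_rest e p m :
  (p - 'X_[e] * mdivX e p)@_m = if (e <= m)%MM then 0 else p@_m.
Proof.
rewrite mcoeffB mulrC mcoeffMX_if; case: ifPn => [em|_]; last by rewrite subr0.
by rewrite mcoeff_mdivX submK ?subrr.
Qed.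

End MonomialDivision.

(** * The contracting homotopy for one odd generator *)

Section Homotopy.
Variables (R : comNzRingType) (n : nat).
Implicit Types (u v : superalg R n) (e : 'X_{1..n}) (k : 'I_n) (S : {set 'I_n}).

Definition super_divX e u : superalg R n := [ffun S => mdivX e (u S)].

Fact super_divX_is_linear e : linear (super_divX e).
Proof. by move=> c u v; apply/ffunP => S; rewrite !ffunE linearP. Qed.
HB.instance Definition _ e := GRing.isLinear.Build R (superalg R n)
  (superalg R n) _ (super_divX e) (super_divX_is_linear e).

Lemma super_divX_deriv e k u :
  super_deriv k (super_divX e u) = super_divX e (super_deriv k u).
Proof.
apply/ffunP => S; rewrite !ffunE; case: ifP; rewrite ?raddf0 // => _.
rewrite /shuffle_sign -signr_odd; case: odd; rewrite ?mul1r //.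
by rewrite !mulN1r raddfN.
Qed.

Lemma superBE u v S : (u - v) S = u S - v S.
Proof. by rewrite !ffunE. Qed.

Lemma super_xiME k u S : (super_xi R k * u) S =
  if k \in S then shuffle_sign R [set k] (S :\ k) * u (S :\ k) else 0.
Proof.
rewrite superME; case: ifPn => [kS|kS].
  rewrite (bigD1 [set k]) ?sub1set //= ffunE eqxx mul1r big1 ?addr0 //.
  by move=> A /andP[_ /negPf Ak]; rewrite ffunE Ak mul0r mulr0.
rewrite big1 // => A AS; rewrite ffunE; case: eqP => [Ak|_].
  by rewrite Ak sub1set (negPf kS) in AS.
by rewrite mul0r mulr0.
Qed.

Lemma super_sign_xi k : super_sign (super_xi R k) = - super_xi R k.
Proof.
apply/ffunP => S; rewrite !ffunE; case: eqP => [->|_]; last by rewrite mulr0 oppr0.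
by rewrite cards1 mulr1.
Qed.

(* u |-> xi_k (u / x^e) is a chain homotopy between the identity and the       *)
(* projection that kills the x^m xi_S with x^e | x^m or k in S.                *)
Lemma koszul_homotopy N k e u :
    koszul_f R n N k = super_even 'X_[e] ->
    (forall (l : 'I_n) v, l != k ->
      super_divX e (koszul_f R n N l * v) = koszul_f R n N l * super_divX e v) ->
    koszul_d N u = 0 -> forall S,
  (u - koszul_d N (super_xi R k * super_divX e u)) S =
    if k \in S then 0 else u S - 'X_[e] * mdivX e (u S).
Proof.
move=> fk fl du S; set v := super_divX e u.
(* Divide [koszul_d N u = 0] by [x^e]: the terms with [l != k] commute with the division, while the
   [k]-th loses its factor [x^e] and leaves [super_deriv k u]. *)
have dv : koszul_d N v = super_even 'X_[e] * super_deriv k v - super_deriv k u.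
  have := congr1 (super_divX e) du; rewrite /koszul_d !(bigD1 k (P := predT)) //=.
  rewrite fk linearD linear_sum linear0 /=.
  rewrite (eq_bigr (fun l : 'I_n => koszul_f R n N l * super_deriv l v)); last first.
    by move=> l lk; rewrite fl // super_divX_deriv.
  move/(canRL (addKr _)); rewrite addr0 => ->; congr (_ - _).
  by apply/ffunP => T; rewrite ffunE super_evenME mdivXK.
rewrite koszul_dM koszul_d_xi super_sign_xi dv fk mulNr.
rewrite !superBE super_evenME super_xiME [v S]ffunE; case: ifPn => kS; last by rewrite subr0.
rewrite superBE super_evenME !ffunE !inE eqxx /= setD1K //.
have := sgn_sqr R [set k] (S :\ k); set s := shuffle_sign _ _ _; set x := 'X_[_].
set w := mdivX _ _; set y := u S => ss.
transitivity ((y - x * w) * (1 - s * s)); first by ring.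
by rewrite ss subrr mulr0.
Qed.

End Homotopy.

(** * Reduced monomials as a basis of homology *)

Section ReducedMonomials.
Variables (F : fieldType) (n N : nat).
Hypothesis NF : N \in [pchar F].
Implicit Types (u v w z : superalg F n) (m : 'X_{1..n}) (S : {set 'I_n}).

Let N_gt0 : (0 < N)%N. Proof. exact/prime_gt0/(pcharf_prime NF). Qed.

Lemma koszul_f_pchar k : koszul_f F n N k =
  super_even (\sum_(i < n | (i * N)%N == k) 'X_[U_(i) *+ N]).
Proof.
rewrite koszul_f_even sum_prodX_pchar //; congr super_even.
by apply: eq_bigr => i _; rewrite mpolyXn.
Qed.

Lemma koszul_f_mulN (i : 'I_n) :
  koszul_f F n N (i * N) = super_even 'X_[U_(i) *+ N].
Proof.
rewrite koszul_f_pchar (big_pred1 i) // => j.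
by rewrite /= eqn_pmul2r // -val_eqE.
Qed.

Lemma koszul_f_ndvd k : ~~ (N %| k)%N -> koszul_f F n N k = 0.
Proof.
move=> Nk; rewrite koszul_f_pchar big1 ?raddf0 // => i /eqP ik.
by rewrite -ik dvdn_mull in Nk.
Qed.

Definition reduced m S : bool :=
  [forall i : 'I_n, (i * N < n)%N ==> (m i < N)%N]
  && [forall (k : 'I_n | k \in S), ~~ (N %| k)%N].

(** The homotopy for [xi_(iN)] and [x_i^N]. Since the support only shrinks, bidegrees are kept and
    earlier reductions are not undone. *)
Lemma cycle_reduce1 (i : 'I_n) z : koszul_d N z = 0 ->
  exists w, forall S m, m \in msupp ((z - koszul_d N w) S) ->
    m \in msupp (z S) /\
    forall k : 'I_n, (i * N)%N = k -> (m i < N)%N /\ k \notin S.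
Proof.
move=> dz; have [iN|niN] := ltnP (i * N)%N n; last first.
  exists 0 => S m; rewrite linear0 subr0 => mz; split=> // k ik.
  by have := ltn_ord k; rewrite -ik ltnNge niN.
pose k := Ordinal iN; pose e := (U_(i) *+ N)%MM.
have fk : koszul_f F n N k = super_even 'X_[e] by exact: koszul_f_mulN.
exists (super_xi F k * super_divX e z) => S m.
rewrite (koszul_homotopy fk) //; last first.
  (* For [l != k], [koszul_f] involves only [x_j^N] with [j != i], which commutes with division by
     [x_i^N]. *)
  move=> l v lk; rewrite koszul_f_pchar; apply/ffunP => T.
  rewrite super_evenME ![super_divX _ _ _]ffunE super_evenME !mulr_suml raddf_sum /=.
  apply: eq_bigr => j /eqP jl; rewrite mdivX_mulX // => h.
  have ij : j != i by apply: contra lk => /eqP ji; rewrite -val_eqE /= -jl ji.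
  rewrite !mulmnE !mnm1E; case: (eqVneq i h) => [<-|_]; last by left.
  by right; rewrite (negPf ij).
case: ifPn => kS; first by rewrite msupp0.
rewrite mcoeff_msupp mcoeff_mdivX_rest; case: ifPn => [_|em]; first by rewrite eqxx.
rewrite -mcoeff_msupp => mz; split=> // k' ik'.
have -> : k' = k by apply/val_inj; rewrite /= -ik'.
split=> //; rewrite ltnNge; apply: contra em => Nm.
apply/mnm_lepP => j; rewrite mulmnE mnm1E.
by case: (eqVneq i j) => [<-|_]; rewrite ?mul1n ?mul0n.
Qed.

Lemma cycle_reduce z : koszul_d N z = 0 ->
  exists w, forall S m, m \in msupp ((z - koszul_d N w) S) ->
    m \in msupp (z S) /\ reduced m S.
Proof.
move=> dz.
suff /(_ (enum 'I_n)) [w wP] : forall s : seq 'I_n, exists w,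
    forall S m, m \in msupp ((z - koszul_d N w) S) -> m \in msupp (z S) /\
    forall i k : 'I_n, i \in s -> (i * N)%N = k -> (m i < N)%N /\ k \notin S.
  exists w => S m /wP[mz red]; split=> //; apply/andP; split.
    apply/forallP => i; apply/implyP => iN.
    by have [] := red i (Ordinal iN) (mem_enum _ i) erefl.
  apply/forallP => k; apply/implyP => kS; apply/negP => /dvdnP[i kE].
  have iN : (i < n)%N.
    by apply: leq_ltn_trans (ltn_ord k); rewrite kE leq_pmulr.
  have [_] := red (Ordinal iN) k (mem_enum _ _) (esym kE).
  by rewrite kS.
elim=> [|i s [w wP]].
  by exists 0 => S m; rewrite linear0 subr0.
have [|w' w'P] := @cycle_reduce1 i (z - koszul_d N w).
  by rewrite linearB /= koszul_dd dz subr0.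
exists (w + w') => S m; rewrite linearD opprD addrA => /w'P[/wP[mz red] redi].
split=> // j k; rewrite inE => /orP[/eqP ->|]; [exact: redi | exact: red].
Qed.

(** Every monomial of [koszul_d N w] is a multiple of some [x_i^N] with [iN = k < n]. *)
Lemma boundary_reduced w m S : reduced m S -> (koszul_d N w S)@_m = 0.
Proof.
move=> /andP[/forallP mN _]; rewrite /koszul_d sum_ffunE raddf_sum big1 // => k _.
rewrite koszul_f_pchar super_evenME mulr_suml raddf_sum big1 //= => i /eqP ik.
rewrite mulrC mcoeffMX_if; case: ifP => // /mnm_lepP/(_ i).
rewrite mulmnE mnm1E eqxx mul1n leqNgt.
by have := mN i; rewrite ik ltn_ord /= => ->.
Qed.

Definition super_mon m S : superalg F n := [ffun T => if T == S then 'X_[m] else 0].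

Lemma mcoeff_super_mon m S m' S' :
  (super_mon m S S')@_m' = ((m', S') == (m, S))%:R.
Proof.
rewrite ffunE xpair_eqE; case: eqP => _; rewrite ?andbT ?andbF ?mcoeff0 //.
by rewrite mcoeffX eq_sym.
Qed.

(** Only the [xi_k] with [k] in [S] are differentiated, and [d_N(xi_k) = 0] because [N] does not
    divide [k]. *)
Lemma super_mon_cycle m S : reduced m S ->
  Defs.cycle N (qdeg N m S) (tdeg m S) (super_mon m S).
Proof.
move=> /andP[_ /forallP NS]; split=> [T m'|].
  rewrite mcoeff_msupp mcoeff_super_mon xpair_eqE.
  by case: andP => [[/eqP -> /eqP ->]|]; rewrite ?eqxx.
rewrite /koszul_d big1 // => k _.
have [Nk|/koszul_f_ndvd ->] := boolP (N %| k)%N; last by rewrite mul0r.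
rewrite [super_deriv _ _](_ : _ = 0) ?mulr0 //; apply/ffunP => T.
rewrite !ffunE; case: ifP => // _; case: eqP => [TS|]; last by rewrite mulr0.
by have := NS k; rewrite -TS setU11 Nk.
Qed.

(* Each x_k has q-degree at least 2, so exponents are bounded by a. *)
Definition reduced_mons (a b : nat) : {set {ffun 'I_n -> 'I_a.+1} * {set 'I_n}} :=
  [set x : {ffun 'I_n -> 'I_a.+1} * {set 'I_n} | let m := [multinom (x.1 k : nat) | k < n] in
     [&& reduced m x.2, qdeg N m x.2 == a & tdeg m x.2 == b]].

Lemma homology_dim_reduced a b : homology_dim F n N a b #|reduced_mons a b|.
Proof.
pose mon (x : {ffun 'I_n -> 'I_a.+1} * {set 'I_n}) : 'X_{1..n} :=
  [multinom (x.1 k : nat) | k < n].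
pose x (j : 'I_#|reduced_mons a b|) := enum_val j.
have xP j : [/\ reduced (mon (x j)) (x j).2, qdeg N (mon (x j)) (x j).2 = a
             & tdeg (mon (x j)) (x j).2 = b].
  by have := enum_valP j; rewrite inE => /and3P[? /eqP ? /eqP ?].
have mon_inj j j' : ((mon (x j), (x j).2) == (mon (x j'), (x j').2)) = (j == j').
  apply/idP/eqP => [|-> //]; rewrite xpair_eqE => /andP[/eqP mm /eqP SS].
  apply: enum_val_inj.
  rewrite -/(x j) -/(x j'); case: (x j) (x j') mm SS => [f S] [f' S'] /= mm ->.
  congr (_, _); apply/ffunP => k; apply: val_inj.
  by have := congr1 (fun m : 'X_{1..n} => m k) mm; rewrite /mon !mnmE.
pose h j := super_mon (mon (x j)) (x j).2.
have coef_h c j : ((\sum_i c i *: h i) (x j).2)@_(mon (x j)) = c j.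
  rewrite sum_ffunE raddf_sum (bigD1 j) //= ffunE mcoeffZ mcoeff_super_mon.
  rewrite eqxx mulr1 big1 ?addr0 // => i ij.
  by rewrite ffunE mcoeffZ mcoeff_super_mon mon_inj eq_sym (negPf ij) mulr0.
exists h; split=> [j|z [hz dz]|c [w hw] j].
- by have [/super_mon_cycle + qa tb] := xP j; rewrite qa tb.
- have [w wP] := cycle_reduce dz; set z' := z - koszul_d N w.
  pose c j := (z' (x j).2)@_(mon (x j)); exists c, w.
  (* The reduced cycle is itself, not just modulo boundaries, the combination of the [h i] given by
     its coefficients. *)
  suff -> : \sum_i c i *: h i = z' by rewrite subKr.
  apply/ffunP => S; apply/mpolyP => m.
  have [mz'|mz'] := boolP (m \in msupp (z' S)).
    have [/hz[qm tm] red] := wP S m mz'.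
    have ma k : (m k < a.+1)%N.
      rewrite ltnS -qm /qdeg (bigD1 k) //= -!addnA (leq_trans _ (leq_addr _ _)) //.
      by rewrite leq_pmulr // !addnA addn2.
    pose y : {ffun 'I_n -> 'I_a.+1} * {set 'I_n} := ([ffun k => Ordinal (ma k)], S).
    have my : mon y = m by apply/mnmP => k; rewrite mnmE ffunE.
    have yE : y \in reduced_mons a b.
      by rewrite inE -/(mon y) my /= red qm tm !eqxx.
    have := coef_h c (enum_rank_in yE y).
    by rewrite /c /x enum_rankK_in // my.
  rewrite sum_ffunE raddf_sum (memN_msupp_eq0 mz') big1 //= => j _.
  rewrite ffunE mcoeffZ mcoeff_super_mon; case: eqP => [[mE SE]|]; last by rewrite mulr0.
  by rewrite /c -mE -SE (memN_msupp_eq0 mz') mul0r.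
- by have [red _ _] := xP j; rewrite -(coef_h c) hw boundary_reduced.
Qed.

End ReducedMonomials.

(** * Truncated power series and product expansions *)

Section PowerSeries.
Variable R : comNzRingType.
Implicit Types u v y : fps R.

(** Congruence modulo the power [a.+1] of the variable: a fixed coefficient then needs only finite
    sums. *)
Definition fps_eq_upto (a : nat) u v : Prop :=
  forall i, (i <= a)%N -> fps_coef u i = fps_coef v i.

Lemma fps_eq_uptoM a u u' v v' :
  fps_eq_upto a u u' -> fps_eq_upto a v v' -> fps_eq_upto a (u * v) (u' * v').
Proof.
move=> uu vv i ia; rewrite !fps_coefM; apply: eq_bigr => j _.
have ji := leq_ord j; rewrite uu ?vv //; last exact: leq_trans ji ia.
exact: leq_trans (leq_subr _ _) ia.
Qed.

Lemma fps_eq_upto_prod a (I : Type) (r : seq I) (u v : I -> fps R) :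
  (forall i, fps_eq_upto a (u i) (v i)) ->
  fps_eq_upto a (\prod_(i <- r) u i) (\prod_(i <- r) v i).
Proof.
move=> uv; elim: r => [|i r IHr]; first by rewrite !big_nil.
by rewrite !big_cons; exact: fps_eq_uptoM.
Qed.

Lemma fps_eq_upto_sumX a m y : fps_coef y 0 = 0 ->
  fps_eq_upto a (\sum_(j < m) y ^+ j) (\sum_(j < a.+1 | (j < m)%N) y ^+ j).
Proof.
move=> y0 i ia; rewrite !fps_coef_sum.
rewrite (big_ord_widen (m + a.+1) (fun j => fps_coef (y ^+ j) i)) ?leq_addr //.
rewrite [RHS](big_ord_widen_cond (m + a.+1) (fun j => j < m)%N
           (fun j => fps_coef (y ^+ j) i)) ?leq_addl //.
rewrite [LHS](bigID (fun j : 'I_(m + a.+1) => (j < a.+1)%N)) /=.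
rewrite [X in _ + X]big1 ?addr0 // => j /andP[_].
rewrite -leqNgt => aj; rewrite fps_coefX_lt //.
exact: leq_ltn_trans ia aj.
Qed.

Lemma fps_coefXn i j : fps_coef (fpsX R ^+ i) j = (i == j)%:R.
Proof.
elim: i j => [|i IHi] j; first by rewrite expr0 fps_coef1 eq_sym.
rewrite exprS fps_coefM big_ord_recl mul0r add0r.
case: j => [|j]; first by rewrite big_ord0.
rewrite big_ord_recl mul1r big1 ?addr0; first by rewrite IHi subSS subn0 eqSS.
by move=> l _; rewrite mul0r.
Qed.

Lemma fpsCX (c : R) i : fpsC c ^+ i = fpsC (c ^+ i).
Proof.
elim: i => [|i IHi]; first by rewrite !expr0.
rewrite !exprS IHi; apply/fpsP => j; rewrite fps_coefCM.
by case: j => //= j; rewrite mulr0.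
Qed.

End PowerSeries.

Lemma fps_unit1D (R : comUnitRingType) (y : fps R) :
  fps_coef y 0 = 0 -> 1 + y \is a GRing.unit.
Proof. by move=> y0; rewrite fps_unitE fps_coefD fps_coef1 y0 addr0 unitr1. Qed.

Lemma fps_unit1B (R : comUnitRingType) (y : fps R) :
  fps_coef y 0 = 0 -> 1 - y \is a GRing.unit.
Proof. by move=> y0; rewrite fps_unit1D // fps_coefN y0 oppr0. Qed.

(** [(1 - y^m) / (1 - y)] is the sum of [y^j] for [j < m], and the powers with [j > a] are invisible
    up to degree [a]. *)
Lemma fps_truncated_geometric (R : comUnitRingType) a m (y : fps R) : fps_coef y 0 = 0 ->
  fps_eq_upto a ((1 - y)^-1 * (1 - y ^+ m)) (\sum_(j < a.+1 | (j < m)%N) y ^+ j).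
Proof.
move=> y0; rewrite -[1 - y ^+ m]opprB subrX1 -mulNr opprB mulKr ?fps_unit1B //.
exact: fps_eq_upto_sumX.
Qed.

Lemma fps_geometric (R : comUnitRingType) a (y : fps R) : fps_coef y 0 = 0 ->
  fps_eq_upto a (1 - y)^-1 (\sum_(j < a.+1) y ^+ j).
Proof.
move=> y0 i ia; have := @fps_truncated_geometric _ a a.+1 _ y0 i ia.
rewrite mulrBr mulr1 fps_coefD fps_coefN fps_coefM [X in _ - X]big1 ?subr0.
  by move=> ->; congr (fps_coef _ _); apply: eq_bigl => j; rewrite ltn_ord.
move=> j _; have ji := leq_ord j.
rewrite (fps_coefX_lt y0) ?mulr0 // ltnS.
exact: leq_trans (leq_subr _ _) ia.
Qed.

Lemma fps_coef_qt i j a b :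
  fps_coef (fps_coef (fps_q ^+ i * fps_t ^+ j) a) b = ((i == a) && (j == b))%:R.
Proof.
rewrite mulrC /fps_t /fps_q fpsCX fps_coefCM fps_coefXn.
case: (i == a); rewrite ?mulr1 ?mulr0 ?fps_coef0 //.
exact: fps_coefXn.
Qed.

Lemma fps_coef_q0 i (u : fps (fps int)) :
  (0 < i)%N -> fps_coef (fps_q ^+ i * u) 0 = 0.
Proof. by move=> i0; rewrite fps_coef0M fps_coefXn gtn_eqF ?mul0r. Qed.

Lemma prod_dvdn (R : comNzRingType) (N n : nat) (G : nat -> R) :
    (0 < N)%N -> (0 < n)%N ->
  \prod_(k < n | (N %| k)%N) G k = \prod_(i < ((n - 1) %/ N).+1) G (i * N)%N.
Proof.
move=> N0; case: n => // n _; rewrite subSS subn0.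
have le_n (i : 'I_(n %/ N).+1) : (i * N <= n)%N by rewrite -leq_divRL // -ltnS.
rewrite (reindex_onto (fun i : 'I_(n %/ N).+1 => inord (i * N) : 'I_n.+1)
                      (fun k => inord (k %/ N))) /=.
  apply: eq_big => [i|i _]; last by rewrite inordK // ltnS le_n.
  by rewrite inordK ?ltnS ?le_n // mulnK // inord_val eqxx dvdn_mull.
move=> k Nk; apply: val_inj; rewrite /= [inord (k %/ N) : nat]inordK ?divnK ?inordK //.
by rewrite ltnS leq_div2r // -ltnS.
Qed.

Lemma prod_1D (R : comNzRingType) (I : finType) (P : pred I) (w : I -> R) :
  \prod_(i | P i) (1 + w i) =
  \sum_(S : {set I} | [forall (i | i \in S), P i]) \prod_(i in S) w i.
Proof.
(* Indices outside [P] get weight 0, so any subset not contained in [P] contributes 0. *)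
rewrite big_mkcond (eq_bigr (fun i => (if P i then w i else 0) + 1)); last first.
  by move=> i _; case: ifP; rewrite ?add0r // addrC.
rewrite bigA_distr [RHS]big_mkcond; apply: eq_bigr => S _.
rewrite -big_mkcond /=; case: ifPn => [/forall_inP SP|].
  by apply: eq_bigr => i /SP ->.
rewrite negb_forall_in => /exists_inP[i iS /negPf nPi].
by rewrite (bigD1 i) //= nPi mul0r.
Qed.

(** * The product formula as a count of reduced monomials *)

Theorem theorem6 (N n : nat) (N_prime : prime N) (n_gt0 : (1 <= n)%N) :
  is_poincare_series 'F_N n N
    (\prod_(k < n)
        ((1 + fps_q ^+ (2 * N + 2 * k) * fps_t ^+ (2 * k + 1))
         / (1 - fps_q ^+ (2 * k + 2) * fps_t ^+ (2 * k)))
     * \prod_(i < ((n - 1) %/ N).+1)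
        ((1 - fps_q ^+ (2 * N + 2 * i * N) * fps_t ^+ (2 * i * N))
         / (1 + fps_q ^+ (2 * N + 2 * i * N) * fps_t ^+ (2 * i * N + 1)))).
Proof.
move=> a b; exists #|reduced_mons n N a b|.
  by apply: homology_dim_reduced; rewrite pchar_Fp.
have N_gt0 := prime_gt0 N_prime.
pose y k := fps_q ^+ (2 * k + 2) * fps_t ^+ (2 * k).
pose w k := fps_q ^+ (2 * N + 2 * k) * fps_t ^+ (2 * k + 1).
have y0 k : fps_coef (y k) 0 = 0 by rewrite fps_coef_q0 // addn2.
have w_unit k : 1 + w k \is a GRing.unit.
  by apply: fps_unit1D; rewrite fps_coef_q0 // addn_gt0 muln_gt0 N_gt0.
(* [A k] is the series of the admissible powers of [x_k]: those below [N] if [kN < n], all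
   otherwise. [A'] is its finite version modulo [q^(a+1)]. *)
pose A k : fps (fps int) := (1 - y k)^-1 * (if (k * N < n)%N then 1 - y k ^+ N else 1).
pose A' k := \sum_(j < a.+1 | (k * N < n)%N ==> (j < N)%N) y k ^+ j.
have AA' k : fps_eq_upto a (A k) (A' k).
  rewrite /A /A'; case: ifP => _ /=; first exact: fps_truncated_geometric.
  by rewrite mulr1; exact: fps_geometric.
set P := _ * _.
have -> : P = \prod_(k < n) A k * \prod_(k < n | ~~ (N %| k)%N) (1 + w k).
  rewrite /P /A !big_split /= (bigID (fun k : 'I_n => (N %| k)%N)) /=.
  rewrite (prod_dvdn (fun k => 1 + w k)) //.
  have -> : \prod_(k < n) (if (k * N < n)%N then 1 - y k ^+ N else 1) =
            \prod_(i < ((n - 1) %/ N).+1) (1 - y i ^+ N).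
    have le_n : (((n - 1) %/ N).+1 <= n)%N by have := leq_div (n - 1) N; lia.
    rewrite (big_ord_widen n (fun i => 1 - y i ^+ N) le_n) [RHS]big_mkcond /=.
    apply: eq_bigr => k _; rewrite ltnS leq_divRL //.
    by have -> : (k * N < n)%N = (k * N <= n - 1)%N by lia.
  set W := \prod_(k < n | _) _; set Y := \prod_(k < n) _.
  set V := \prod_(i < _) _; set Z := \prod_(i < _) _; set Z' := \prod_(i < _) (1 - _).
  set V' := \prod_(i < _) _^-1.
  (* [y i ^+ N] has bidegree [q^(2N+2iN) t^(2iN)]. *)
  have -> : Z = Z'.
    apply: eq_bigr => i _; rewrite exprMn -!exprM.
    by congr (1 - _ ^+ _ * _ ^+ _); lia.
  have VV' : V * V' = 1.
    rewrite -big_split big1 //= => i _.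
    rewrite -[RHS](mulrV (w_unit (i * N)%N)); congr (_ * (1 + _ ^+ _ * _ ^+ _)^-1); lia.
  transitivity (W * Y * Z' * (V * V')); first by ring.
  by rewrite VV'; ring.
rewrite (fps_eq_uptoM (fps_eq_upto_prod _ (fun k : 'I_n => AA' k)) (fun _ _ => erefl)) //.
(* Expanding indexes the terms by an exponent vector [f] and a set [S] of odd generators, with
   exactly the constraints of [reduced]. *)
rewrite bigA_distr_big_dep prod_1D big_distrlr /= pair_big /=.
pose mon (f : {ffun 'I_n -> 'I_a.+1}) : 'X_{1..n} := [multinom (f k : nat) | k < n].
have monomialE (f : {ffun 'I_n -> 'I_a.+1}) (S : {set 'I_n}) :
    \prod_(k < n) y k ^+ f k * \prod_(k in S) w k =
    fps_q ^+ qdeg N (mon f) S * fps_t ^+ tdeg (mon f) S.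
  rewrite (eq_bigr (fun k : 'I_n => fps_q ^+ (mon f k * (2 * k + 2)) *
                                    fps_t ^+ (mon f k * (2 * k)))); last first.
    by move=> k _; rewrite mnmE exprMn -!exprM ![(f k * _)%N]mulnC.
  rewrite !big_split /= -!(big_morph _ (exprD _) (expr0 _)) /qdeg /tdeg !exprD.
  by ring.
under eq_bigr => x _ do rewrite monomialE.
rewrite !fps_coef_sum; under eq_bigr => x _ do rewrite fps_coef_qt.
rewrite -sum1_card natr_sum [RHS]big_mkcond [LHS]big_mkcond /=.
apply: eq_bigr => -[f S] _; rewrite [_ \in reduced_mons _ _ _ _]inE /= -/(mon f) /reduced.
rewrite [f \in _](_ : _ = [forall i : 'I_n, (i * N < n)%N ==> (mon f i < N)%N]); last first.
  by rewrite inE; apply: eq_forallb => k; rewrite mnmE.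
by case: (_ && [forall k in S, _]) => //=; case: (_ && _).
Qed.
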